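(* Let $n,m,\zeta$ be positive integers with $\zeta m=n$, and let $h_{\rm b}>0$ and $h_{\rm o}=\zeta h_{\rm b}$. Let $M_{\rm b},M_{\rm o}$ be positive integers and let $L_{\rm b},L_{\rm o},\sigma_{\rm b},\sigma_{\rm o}>0$. Let $\mathbf{B}\in\mathbb{R}^{n\times n}$ and $\mathbf{R}\in\mathbb{R}^{m\times m}$ be the circulant matrices $$\mathbf{B}=\frac{\sigma_{\rm b}^2\nu_{\rm b}L_{\rm b}}{h_{\rm b}}\left(\mathbf{I}_n-L_{\rm b}^2\,\mathbf{\Delta}_{h_{\rm b}}\right)^{-M_{\rm b}},\qquad \mathbf{R}=\frac{\sigma_{\rm o}^2\nu_{\rm o}L_{\rm o}}{h_{\rm o}}\left(\mathbf{I}_m-L_{\rm o}^2\,\mathbf{\Delta}_{h_{\rm o}}\right)^{-M_{\rm o}},$$ where $\mathbf{\Delta}_{h_{\rm b}}\in\mathbb{R}^{n\times n}$ and $\mathbf{\Delta}_{h_{\rm o}}\in\mathbb{R}^{m\times m}$ are the periodic finite-difference Laplacian matrices. Let $\mathbf{U}\in\mathbb{R}^{n\times n}$ satisfy $\mathbf{B}=\mathbf{U}\mathbf{U}^{\mathsf T}$, and let $\mathbf{H}\in\mathbb{R}^{m\times n}$ be the uniform selection operator selecting every $\zeta$-th grid point. If $$\mathbf{S}=\mathbf{I}_n+\mathbf{U}^{\mathsf T}\mathbf{H}^{\mathsf T}\mathbf{R}^{-1}\mathbf{H}\mathbf{U},$$ then the $n$ eigenvalues of $\mathbf{S}$, counted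 with multiplicity and suitably indexed by $i\in\{0,\dots,n-1\}$, are $$\lambda_i(\mathbf{S})=\begin{cases}1+\alpha\displaystyle\sum_{r=0}^{\zeta-1}\frac{\left[1+4\widetilde{L}_{\rm o}^2\sin^2\left(\pi\frac{i}{m}\right)\right]^{M_{\rm o}}}{\left[1+4\widetilde{L}_{\rm b}^2\sin^2\left(\pi\frac{i+rm}{\zeta m}\right)\right]^{M_{\rm b}}}&\text{if } i\in\{0,\dots,m-1\},\\[2ex]1&\text{otherwise,}\end{cases}$$ with $\widetilde{L}_{\rm o}=L_{\rm o}/h_{\rm o}$, $\widetilde{L}_{\rm b}=L_{\rm b}/h_{\rm b}$ and $$\alpha=\frac{\sigma_{\rm b}^2\nu_{\rm b}L_{\rm b}}{\sigma_{\rm o}^2\nu_{\rm o}L_{\rm o}}.$$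
   Context: $\mathbf{I}_k$ is the $k\times k$ identity matrix. For a positive integer $k$ and $h>0$, the periodic finite-difference Laplacian matrix $\mathbf{\Delta}_h\in\mathbb{R}^{k\times k}$ acts by $(\mathbf{\Delta}_h u)_p=\frac{1}{h^2}(u_{p+1}-2u_p+u_{p-1})$, $p\in\{0,\dots,k-1\}$, with indices taken modulo $k$ (circulant, with $-2/h^2$ on the diagonal, $1/h^2$ on the first off-diagonals and in the two corners). The constants $\nu_{\rm b}=\nu(M_{\rm b})$ and $\nu_{\rm o}=\nu(M_{\rm o})$ are given by $\nu(M)=\dfrac{2^{2M-1}[(M-1)!]^2}{(2M-2)!}>0$. The uniform selection operator $\mathbf{H}\in\mathbb{R}^{m\times n}$ (with $n=\zeta m$) is the 0-1 matrix with $(\mathbf{H}u)_p=u_{\zeta p}$ for $p\in\{0,\dots,m-1\}$, rows and columns being indexed from $0$. *)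

(* Defs.v *)
From mathcomp Require Import all_boot all_order all_algebra.
From mathcomp Require Import all_classical reals trigo.
Set Implicit Arguments.
Unset Strict Implicit.
Unset Printing Implicit Defensive.
Import Order.TTheory GRing.Theory Num.Theory.
Local Open Scope ring_scope.

Definition nu (R : realType) (M : nat) : R :=
  2 ^+ (2 * M - 1)%N * ((M - 1)`!%:R) ^+ 2 / ((2 * M - 2)`!)%:R.

(* [ordS] and [ord_pred] are successor and predecessor modulo [k].  The two
   neighbour terms are added, so that they accumulate when they coincide
   (k = 2) and cancel the diagonal when all three coincide (k = 1); see
   [laplacianE]. *)
Definition laplacian (R : realType) (k : nat) (h : R) : 'M[R]_k :=
  \matrix_(p, q) ((h ^+ 2)^-1 *
    ((q == ordS p)%:R - 2 * (q == p)%:R + (q == ord_pred p)%:R)).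

Lemma laplacianE (R : realType) (k : nat) (h : R) (u : 'cV[R]_k) (p : 'I_k) :
  (laplacian k h *m u) p 0 =
    (h ^+ 2)^-1 * (u (ordS p) 0 - 2 * u p 0 + u (ord_pred p) 0).
Proof.
have pick (a : 'I_k) : \sum_q (q == a)%:R * u q 0 = u a 0.
  rewrite (bigD1 a) //= eqxx mul1r big1 ?addr0 // => q /negbTE ->.
  by rewrite mul0r.
rewrite mxE -!pick mulr_sumr -sumrB -big_split /= mulr_sumr.
by apply: eq_bigr => q _; rewrite mxE -mulrA mulrDl mulrBl -(mulrA 2).
Qed.

(* [invmx] is the true inverse here: for h > 0 the matrix I - L^2 Delta_h is
   symmetric positive definite. *)
Definition diffusion_cov (R : realType) (k M : nat) (sigma L h : R) : 'M[R]_k :=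
  (sigma ^+ 2 * nu R M * L / h) *:
    (invmx (1%:M - L ^+ 2 *: laplacian k h)) ^+ M.

Definition selection (R : realType) (m n zeta : nat) : 'M[R]_(m, n) :=
  \matrix_(p, q) (q == zeta * p :> nat)%N%:R.

Lemma selectionE (R : realType) (m n zeta : nat) (u : 'cV[R]_n)
    (p : 'I_m) (q : 'I_n) :
  q = (zeta * p)%N :> nat -> (selection R m n zeta *m u) p 0 = u q 0.
Proof.
move=> qE; rewrite mxE (bigD1 q) //= mxE qE eqxx mul1r big1 ?addr0 // => j jq.
by rewrite mxE -qE val_eqE (negbTE jq) mul0r.
Qed.

(* Main.v *)
(* The real vectors p |-> cas (2 pi p q / k), with cas = cos + sin, form
   an orthogonal basis of R^k diagonalizing every symmetric circulant matrix,
   so B and R are diagonal in it and no complex Fourier matrix is needed.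
   With Y = R^-1 H U and X = U^T H^T one has S = I + X Y, and X Y has the characteristic polynomial of
   Y X = R^-1 H B H^T up to the factor 'X^(n - m).  Subsampling the fine-grid
   basis gives the coarse-grid basis with the frequencies i + r m folded
   onto i, hence Y X is diagonal too, with the announced sums as entries. *)
Require Import Defs.
From mathcomp Require Import all_boot all_order all_algebra.
From mathcomp Require Import all_classical reals trigo.
From mathcomp Require Import zify ring.
Set Implicit Arguments.
Unset Strict Implicit.
Unset Printing Implicit Defensive.
Import Order.TTheory GRing.Theory Num.Theory.
Local Open Scope ring_scope.

(** * Characteristic polynomials of products, conjugates and shifts *)

(** Two block eliminations of the same matrix [K]: one multiplies it by a factor of determinant 1,
    the other by a factor of determinant [t ^+ n]. Nothing is divided by [t], so [t] may be the
    indeterminate. *)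
Lemma det_scalar_sub_mulmxC (R : comNzRingType) (m n : nat) (t : R)
    (A : 'M[R]_(m, n)) (B : 'M[R]_(n, m)) :
  t ^+ n * \det (t%:M - A *m B) = t ^+ m * \det (t%:M - B *m A).
Proof.
pose K := block_mx (t%:M : 'M_m) A B (1%:M : 'M_n).
have KL : K *m block_mx 1%:M 0 (- B) 1%:M =
    block_mx (t%:M - A *m B) A 0 1%:M.
  rewrite mulmx_block !mulmx1 !mulmx0 !add0r !mul1mx mulmxN.
  by rewrite subrr.
have KR : K *m block_mx 1%:M (- A) 0 t%:M =
    block_mx t%:M 0 B (t%:M - B *m A).
  rewrite mulmx_block !mulmx1 !mulmx0 !addr0 mul1mx !mulmxN.
  by rewrite mul_scalar_mx mul_mx_scalar addNr addrC.
have := congr1 determinant KL; have := congr1 determinant KR.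
rewrite !det_mulmx !det_ublock !det_lblock !det1 !det_scalar !mulr1 !mul1r.
by move=> <- <-; rewrite mulrC.
Qed.

Lemma char_poly_mulmxC (R : comNzRingType) (m n : nat)
    (A : 'M[R]_(m, n)) (B : 'M[R]_(n, m)) :
  'X^n * char_poly (A *m B) = 'X^m * char_poly (B *m A).
Proof. by rewrite /char_poly /char_poly_mx !map_mxM det_scalar_sub_mulmxC. Qed.

(** Swapping [P] with [A *m Q] costs the same power of 'X on both sides; cancelling it needs an
    integral domain. *)
Lemma char_poly_conj (R : idomainType) (n : nat) (P Q A : 'M[R]_n) :
  Q *m P = 1%:M -> char_poly (P *m A *m Q) = char_poly A.
Proof.
move=> QP; have := char_poly_mulmxC P (A *m Q).
rewrite mulmxA -[A *m Q *m P]mulmxA QP mulmx1.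
by apply: mulfI; rewrite expf_neq0 ?polyX_eq0.
Qed.

Lemma char_poly_diag (R : comNzRingType) (n : nat) (d : 'rV[R]_n) :
  char_poly (diag_mx d) = \prod_i ('X - (d 0 i)%:P).
Proof.
rewrite char_poly_trig ?diag_mx_is_trig//.
by apply: eq_bigr => i _; rewrite mxE eqxx mulr1n.
Qed.

(** Substituting ['X - 1] for 'X is a ring morphism, so it commutes with the determinant. *)
Lemma char_poly_add1 (R : comNzRingType) (n : nat) (A : 'M[R]_n) :
  char_poly (1%:M + A) = char_poly A \Po ('X - 1).
Proof.
rewrite /char_poly -det_map_mx; congr (\det _).
apply/matrixP => i j; rewrite !mxE rmorphB /= comp_polyC.
case: eqP => _; rewrite ?mulr1n ?mulr0n ?add0r ?sub0r.
  by rewrite comp_polyX polyCD polyC1 opprD addrA.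
by rewrite comp_poly0 sub0r.
Qed.

(** * Orthogonality of the discrete Hartley basis *)

Section Hartley.
Variable R : realType.

(** The argument is a natural number, so that products of indices can be reduced modulo [k]. *)
Definition cas (k a : nat) : R :=
  cos (2 * pi * (a%:R / k%:R)) + sin (2 * pi * (a%:R / k%:R)).

Definition hartley (k : nat) : 'M[R]_k := \matrix_(p, q) cas k (p * q).

Lemma cas_addM (k a b : nat) : (0 < k)%N -> cas k (a + k * b) = cas k a.
Proof.
move=> k0; have kR : k%:R != 0 :> R by rewrite pnatr_eq0 -lt0n.
rewrite /cas.
have -> : 2 * pi * ((a + k * b)%:R / k%:R) =
    2 * pi * (a%:R / k%:R) + pi *+ 2 *+ b :> R.
  by rewrite natrD natrM -(mulr_natl (_ *+ 2)) -(mulr_natl pi); field.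
by rewrite (periodicn (@sinD2pi R)) (periodicn (@cosD2pi R)).
Qed.

Lemma cas_mod (k a b : nat) : (0 < k)%N -> a = b %[mod k] -> cas k a = cas k b.
Proof.
move=> k0 ab; rewrite (divn_eq a k) (divn_eq b k) ab.
by rewrite ![(_ * k + _)%N]addnC ![(_ * k)%N]mulnC !cas_addM.
Qed.

(* The differences of [sin ((2 p - 1) y + c)] telescope. *)
Lemma sum_cos_arith (k l : nat) (y c : R) :
  k%:R * y = pi * l%:R ->
  sin y * \sum_(p < k) cos (2 * y * p%:R + c) = 0.
Proof.
move=> kyl.
have tel N : 2 * (sin y * \sum_(p < N) cos (2 * y * p%:R + c)) =
    sin (2 * y * N%:R + c - y) - sin (c - y).
  elim: N => [|N IH].
    by rewrite big_ord0 !mulr0 add0r subrr.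
  rewrite big_ord_recr /= !mulrDr IH.
  have -> : 2 * y * N.+1%:R + c - y = (2 * y * N%:R + c) + y.
    by rewrite -natr1; ring.
  by rewrite (sinD _ y) (sinB (_ + c) y); ring.
apply: (@mulfI _ 2); first by rewrite pnatr_eq0.
rewrite tel mulr0.
have -> : 2 * y * k%:R + c - y = (c - y) + pi *+ 2 *+ l.
  by rewrite -mulrA (mulrC y) kyl -(mulr_natl (_ *+ 2)) -(mulr_natl pi); ring.
by rewrite (periodicn (@sinD2pi R)) subrr.
Qed.

Lemma sin_double_arith (y : R) (p : nat) : sin y = 0 -> sin (2 * y * p%:R) = 0.
Proof.
move=> sy; have s2 : sin (2 * y) = 0.
  by rewrite mulr_natl sin_mulr2n sy mulr0 mul0rn.
elim: p => [|p IH]; first by rewrite mulr0 sin0.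
by rewrite -[p.+1%:R]natr1 mulrDr mulr1 sinD IH s2 mul0r mulr0 addr0.
Qed.

(** If [sin y = 0] every term vanishes; otherwise the phase [- (pi / 2)] turns the cosines of
    [sum_cos_arith] into sines. *)
Lemma sum_sin_roots (k s : nat) : (0 < k)%N ->
  \sum_(p < k) sin (2 * (pi * (s%:R / k%:R)) * p%:R) = 0 :> R.
Proof.
move=> k0; have kR : k%:R != 0 :> R by rewrite pnatr_eq0 -lt0n.
set y := pi * _.
have [sy|sy] := eqVneq (sin y) 0.
  by rewrite big1// => p _; exact: sin_double_arith.
have ky : k%:R * y = pi * s%:R by rewrite /y; field.
have /eqP := sum_cos_arith (- (pi / 2)) ky.
rewrite mulf_eq0 (negbTE sy) /= => /eqP e; rewrite -[RHS]e.
by apply: eq_bigr => p _; rewrite cosBpihalf.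
Qed.

Lemma sum_cos_roots (k s : nat) : (0 < s < k)%N ->
  \sum_(p < k) cos (2 * (pi * (s%:R / k%:R)) * p%:R) = 0 :> R.
Proof.
move=> /andP[s0 sk].
have k0 := ltn_trans s0 sk; have kR : 0 < k%:R :> R by rewrite ltr0n.
have ky : k%:R * (pi * (s%:R / k%:R)) = pi * s%:R :> R.
  by field; rewrite gt_eqF.
have := sum_cos_arith 0 ky; set y := pi * _ => /eqP.
(* The bounds on [s] put [y] strictly between 0 and [pi], so [sin y] can be cancelled. *)
have sy : 0 < sin y.
  apply: sin_gt0_pi; rewrite /y mulr_gt0 ?pi_gt0 ?divr_gt0 ?ltr0n//=.
  by rewrite -[ltRHS]mulr1 ltr_pM2l ?pi_gt0// ltr_pdivrMr// mul1r ltr_nat.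
rewrite mulf_eq0 gt_eqF//= => /eqP e; rewrite -[RHS]e.
by apply: eq_bigr => p _; rewrite addr0.
Qed.

Lemma hartley_sqr (k : nat) : (0 < k)%N -> hartley k *m hartley k = k%:R%:M.
Proof.
move=> k0; have kR : k%:R != 0 :> R by rewrite pnatr_eq0 -lt0n.
apply/matrixP => i j; rewrite !mxE.
(* [C] takes a real argument because [i - j] may be negative; evenness then reduces to a positive
   difference. *)
pose C (x : R) := \sum_(p < k) cos (2 * (pi * (x / k%:R)) * p%:R).
have -> : \sum_p hartley k i p * hartley k p j = C (i%:R - j%:R).
  (* The product of two [cas] values at angles a and b is cos (a - b) + sin (a + b); the sine parts
     sum to zero. *)
  rewrite -[RHS]addr0 -[X in _ = _ + X](sum_sin_roots (i + j) k0).
  rewrite -big_split /=.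
  apply: eq_bigr => p _; rewrite !mxE /cas !natrM natrD.
  set a := 2 * pi * (i%:R * p%:R / k%:R); set b := 2 * pi * (p%:R * _ / _).
  have -> : 2 * (pi * ((i%:R - j%:R) / k%:R)) * p%:R = a - b.
    by rewrite /a /b; field.
  have -> : 2 * (pi * ((i%:R + j%:R) / k%:R)) * p%:R = a + b.
    by rewrite /a /b; field.
  by rewrite cosB sinD; ring.
have CN x : C (- x) = C x.
  apply: eq_bigr => p _.
  by rewrite mulNr !mulrN mulNr cosN.
have C0 a b : (a < b < k)%N -> C (b%:R - a%:R) = 0.
  move=> /andP[ab bk]; rewrite -natrB 1?ltnW// /C sum_cos_roots//.
  by rewrite subn_gt0 ab (leq_ltn_trans _ bk)// leq_subr.
have [->|ij] := eqVneq i j.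
  rewrite mulr1n subrr /C.
  under eq_bigr do rewrite mul0r !mulr0 mul0r cos0.
  by rewrite sumr_const card_ord.
rewrite mulr0n; have [lt|lt|/val_inj e] := ltngtP i j.
- by rewrite -opprB CN C0// lt ltn_ord.
- by rewrite C0// lt ltn_ord.
- by rewrite e eqxx in ij.
Qed.

(** * Spectral form of the covariance matrices and their inverses *)

(** The eigenvalue of [1%:M - L ^+ 2 *: laplacian k h] at frequency [j], from 2 - 2 cos (2 y) = 4
    sin^2 y. *)
Definition symbol (k : nat) (L h : R) (j : nat) : R :=
  1 + 4 * (L / h) ^+ 2 * sin (pi * (j%:R / k%:R)) ^+ 2.

Lemma symbol_gt0 k L h j : 0 < symbol k L h j.
Proof.
by rewrite /symbol ltr_pwDl// mulr_ge0 ?sqr_ge0// mulr_ge0 ?sqr_ge0.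
Qed.

Lemma diffusion_hartley (k : nat) (L h : R) : (0 < k)%N ->
  (1%:M - L ^+ 2 *: laplacian k h) *m hartley k =
  hartley k *m diag_mx (\row_j symbol k L h j).
Proof.
move=> k0; have kR : k%:R != 0 :> R by rewrite pnatr_eq0 -lt0n.
apply/matrixP => p j.
rewrite mul_mx_diag mulmxBl mul1mx -scalemxAl !mxE.
have := laplacianE h (col j (hartley k)) p.
have -> : (laplacian k h *m col j (hartley k)) p 0 =
    \sum_q laplacian k h p q * hartley k q j.
  by rewrite mxE; apply: eq_bigr => q _; rewrite !mxE.
move=> ->; rewrite !mxE.
have -> : cas k (ordS p * j) = cas k (p * j + j).
  by apply: cas_mod => //=; rewrite modnMml mulSn addnC.
have -> : cas k (ord_pred p * j) = cas k ((p + k).-1 * j).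
  by apply: cas_mod => //=; rewrite modnMml.
(* Adding the period [k * j] makes the three arguments a, a + j, a + 2 j, with no truncated
   predecessor at [p = 0]. *)
rewrite -(cas_addM (p * j) j k0).
have -> : (p * j + k * j = (p + k).-1 * j + j)%N by nia.
have -> : cas k (p * j + j) = cas k ((p + k).-1 * j + j + j).
  apply: cas_mod => //.
  have -> : ((p + k).-1 * j + j + j = j * k + (p * j + j))%N by nia.
  by rewrite modnMDl.
set a := ((p + k).-1 * j)%N; rewrite /cas /symbol !natrD.
set y := pi * _; set x := 2 * pi * ((a%:R + j%:R) / k%:R).
have -> : 2 * pi * (a%:R / k%:R) = x - y *+ 2.
  by rewrite -(mulr_natl y) /x /y; field.
have -> : 2 * pi * ((a%:R + j%:R + j%:R) / k%:R) = x + y *+ 2.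
  by rewrite -(mulr_natl y) /x /y; field.
rewrite cosD cosB (sinD x (_ *+ 2)) (sinB x) cos_mulr2n cos2sin2.
by rewrite exprMn exprVn; ring.
Qed.

Lemma invmx_exp_conj (k M : nat) (A P Q : 'M[R]_k) (d : 'I_k -> R) :
  P *m Q = 1%:M -> (forall j, d j != 0) ->
  A *m P = P *m diag_mx (\row_j d j) ->
  invmx A ^+ M = P *m diag_mx (\row_j (d j ^- M)) *m Q.
Proof.
move=> PQ d0 AP; have QP := mulmx1C PQ.
(* An explicit right inverse also shows that [A] is a unit, so [invmx A] is not its default
   value. *)
have AE : A *m (P *m diag_mx (\row_j (d j)^-1) *m Q) = 1%:M.
  rewrite !mulmxA AP -(mulmxA P) mulmx_diag.
  have -> : \row_j ((\row_j d j) 0 j * (\row_j (d j)^-1) 0 j) = const_mx 1.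
    by apply/rowP => j; rewrite !mxE divff.
  by rewrite diag_const_mx mulmx1.
have [uA _] := mulmx1_unit AE.
have -> : invmx A = P *m diag_mx (\row_j (d j)^-1) *m Q.
  by rewrite -[LHS]mulmx1 -AE mulKmx.
elim: M => [|M IH].
  rewrite expr0.
  have -> : \row_j (d j ^- 0) = const_mx 1.
    by apply/rowP => j; rewrite !mxE expr0 invr1.
  by rewrite diag_const_mx mulmx1 PQ.
rewrite exprS IH -mulmxE !mulmxA -(mulmxA _ Q P) QP mulmx1.
rewrite -(mulmxA P (diag_mx _) (diag_mx _)) mulmx_diag.
congr (_ *m diag_mx _ *m _).
by apply/rowP => j; rewrite !mxE exprS invfM.
Qed.

Definition cov_scale (M : nat) (sigma L h : R) := sigma ^+ 2 * nu R M * L / h.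

Lemma diffusion_covE (k M : nat) (sigma L h : R) : (0 < k)%N ->
  diffusion_cov k M sigma L h =
  (cov_scale M sigma L h / k%:R) *:
    (hartley k *m diag_mx (\row_j (symbol k L h j ^- M)) *m hartley k).
Proof.
move=> k0; have kR : k%:R != 0 :> R by rewrite pnatr_eq0 -lt0n.
rewrite /diffusion_cov -/(cov_scale M sigma L h) -scalerA; congr (_ *: _).
rewrite (invmx_exp_conj M (Q := k%:R^-1 *: hartley k) _ _
  (diffusion_hartley L h k0)); last 2 first.
- by rewrite -scalemxAr hartley_sqr// scale_scalar_mx mulVf.
- by move=> j; rewrite gt_eqF ?symbol_gt0.
by rewrite -scalemxAr.
Qed.

Lemma cov_scale_gt0 (M : nat) (sigma L h : R) :
  0 < sigma -> 0 < L -> 0 < h -> 0 < cov_scale M sigma L h.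
Proof.
by move=> s0 L0 h0; rewrite !mulr_gt0 ?invr_gt0 ?exprn_gt0 ?ltr0n ?fact_gt0.
Qed.

Lemma invmx_diffusion_cov (k M : nat) (sigma L h : R) :
  (0 < k)%N -> 0 < sigma -> 0 < L -> 0 < h ->
  invmx (diffusion_cov k M sigma L h) =
  (cov_scale M sigma L h * k%:R)^-1 *:
    (hartley k *m diag_mx (\row_j (symbol k L h j ^+ M)) *m hartley k).
Proof.
move=> k0 s0 L0 h0; have kR : k%:R != 0 :> R by rewrite pnatr_eq0 -lt0n.
have c0 := cov_scale_gt0 M s0 L0 h0.
set B := RHS; have AB : diffusion_cov k M sigma L h *m B = 1%:M.
  rewrite diffusion_covE// -scalemxAl -scalemxAr scalerA !mulmxA.
  rewrite -(mulmxA _ (hartley k) (hartley k)) hartley_sqr// mul_mx_scalar.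
  rewrite -!scalemxAl -(mulmxA (hartley k)) mulmx_diag scalerA.
  have -> : \row_j ((\row_j (symbol k L h j ^- M)) 0 j *
      (\row_j (symbol k L h j ^+ M)) 0 j) = const_mx 1 :> 'rV[R]_k.
    by apply/rowP => j; rewrite !mxE mulVf ?expf_neq0 ?gt_eqF ?symbol_gt0.
  rewrite diag_const_mx mulmx1 hartley_sqr// scale_scalar_mx.
  (* The two Hartley squares contribute [k] each, against one factor [k^-1] from each matrix. *)
  by congr (_%:M); field; rewrite kR gt_eqF.
have [uA _] := mulmx1_unit AB.
by rewrite -[LHS]mulmx1 -AB mulKmx.
Qed.

(** * Aliasing of frequencies under subsampling *)

Lemma sum_ord_mul (m z : nat) (F : nat -> R) :
  \sum_(j < z * m) F j = \sum_(i < m) \sum_(r < z) F (i + r * m)%N.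
Proof.
rewrite exchange_big /=; elim: z => [|z IH]; first by rewrite !big_ord0.
rewrite big_ord_recr /= -IH -!(big_mkord xpredT F).
rewrite (@big_cat_nat _ _ _ (z * m)) ?leq_mul//=; congr (_ + _).
rewrite -{1}[(z * m)%N]add0n big_addn mulSn addnK big_mkord.
by apply: eq_bigr => i _.
Qed.

(* Sampling the Hartley vectors of the fine grid aliases the frequencies
   [i + r m], [r < zeta], onto the frequency [i] of the coarse grid. *)
Lemma selection_conj_hartley (m zeta : nat) (d : nat -> R) :
  (0 < m)%N -> (0 < zeta)%N ->
  selection R m (zeta * m) zeta *m
    (hartley (zeta * m) *m diag_mx (\row_j d j) *m hartley (zeta * m)) *m
    (selection R m (zeta * m) zeta)^T =
  hartley m *m diag_mx (\row_i \sum_(r < zeta) d (i + r * m)%N) *m hartley m.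
Proof.
move=> m0 z0.
have zR : zeta%:R != 0 :> R by rewrite pnatr_eq0 -lt0n.
have mR : m%:R != 0 :> R by rewrite pnatr_eq0 -lt0n.
set n := (zeta * m)%N; set G := hartley n *m _ *m _.
apply/matrixP => p q.
have lt_sel (a : 'I_m) : (zeta * a < n)%N by rewrite ltn_pmul2l.
have sel (k : nat) (A : 'M[R]_(n, k)) (a : 'I_m) b :
    (selection R m n zeta *m A) a b = A (Ordinal (lt_sel a)) b.
  have := @selectionE R m n zeta (col b A) a (Ordinal (lt_sel a)) erefl.
  by rewrite !mxE => <-; apply: eq_bigr => j _; rewrite !mxE.
(* Transposing twice turns the column selection on the right into a row selection, so [sel] applies
   on both sides. *)
set W := selection R m n zeta; rewrite -[_ *m W^T]trmxK trmx_mul trmxK.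
rewrite [LHS]mxE sel mxE sel mxE [RHS]mxE.
pose F (j : nat) := cas n (zeta * p * j) * d j * cas n (j * (zeta * q)).
transitivity (\sum_(j < n) F j).
  by apply: eq_bigr => j _; rewrite mul_mx_diag !mxE.
rewrite sum_ord_mul; apply: eq_bigr => i _.
rewrite mul_mx_diag !mxE mulr_sumr mulr_suml; apply: eq_bigr => r _.
(* The fine-grid point of index [zeta * a] is the coarse-grid point of index [a]. *)
have casE a : cas n (zeta * a) = cas m a.
  rewrite /cas natrM [n%:R]natrM.
  suff -> : zeta%:R * a%:R / (zeta%:R * m%:R) = a%:R / m%:R :> R by [].
  by field; rewrite mR zR.
rewrite /F -mulnA casE mulnCA casE; congr (_ * _ * _); apply: cas_mod => //.
  by rewrite mulnDr mulnA addnC modnMDl.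
by rewrite mulnDl addnC mulnAC modnMDl.
Qed.

End Hartley.

(** * The spectrum of [S] *)

Theorem theorem3 (R : realType) (n m zeta : nat) (hb ho : R) (Mb Mo : nat)
    (Lb Lo sigmab sigmao : R) (B U S : 'M[R]_n) (Rcov : 'M[R]_m)
    (H : 'M[R]_(m, n)) :
  (0 < n)%N -> (0 < m)%N -> (0 < zeta)%N -> (zeta * m)%N = n ->
  0 < hb -> ho = zeta%:R * hb ->
  (0 < Mb)%N -> (0 < Mo)%N ->
  0 < Lb -> 0 < Lo -> 0 < sigmab -> 0 < sigmao ->
  B = diffusion_cov n Mb sigmab Lb hb ->
  Rcov = diffusion_cov m Mo sigmao Lo ho ->
  B = U *m U^T ->
  H = selection R m n zeta ->
  S = 1%:M + U^T *m H^T *m invmx Rcov *m H *m U ->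
  let alpha := (sigmab ^+ 2 * nu R Mb * Lb) / (sigmao ^+ 2 * nu R Mo * Lo) in
  let lambda (i : 'I_n) : R :=
    if (i < m)%N then
      1 + alpha * \sum_(r < zeta)
        (1 + 4 * (Lo / ho) ^+ 2 * sin (pi * (i%:R / m%:R)) ^+ 2) ^+ Mo
        / (1 + 4 * (Lb / hb) ^+ 2
             * sin (pi * ((i + r * m)%:R / (zeta * m)%:R)) ^+ 2) ^+ Mb
    else 1 in
  char_poly S = \prod_(i < n) ('X - (lambda i)%:P).
Proof.
move=> n0 m0 z0 nE hb0 hoE _ _ Lb0 Lo0 sb0 so0 BE RE BU HE SE alpha.
pose mu (i : nat) := alpha * \sum_(r < zeta)
  symbol m Lo ho i ^+ Mo / symbol n Lb hb (i + r * m) ^+ Mb.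
move=> lambda.
have lambdaE i : lambda i = 1 + (if (i < m)%N then mu i else 0).
  by rewrite /lambda /mu /symbol nE; case: ifP => // _; rewrite addr0.
have zR : zeta%:R != 0 :> R by rewrite pnatr_eq0 -lt0n.
have mR : m%:R != 0 :> R by rewrite pnatr_eq0 -lt0n.
have ho0 : 0 < ho by rewrite hoE mulr_gt0 ?ltr0n.
pose Y := invmx Rcov *m H *m U; pose X := U^T *m H^T.
have YX : Y *m X =
    hartley R m *m diag_mx (\row_i mu i) *m (m%:R^-1 *: hartley R m).
  (* [U] enters only through [U *m U^T], so every such factor of [B] gives the same spectrum. *)
  have -> : Y *m X = invmx Rcov *m (H *m B *m H^T) by rewrite BU !mulmxA.
  rewrite RE invmx_diffusion_cov// BE diffusion_covE// HE.
  rewrite -!(scalemxAl, scalemxAr) !scalerA; subst n.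
  rewrite (selection_conj_hartley (fun j => symbol (zeta * m) Lb hb j ^- Mb))//.
  rewrite !mulmxA -(mulmxA _ (hartley R m) (hartley R m)) hartley_sqr//.
  rewrite mul_mx_scalar -!scalemxAl -(mulmxA (hartley R m)) mulmx_diag scalerA.
  have -> : \row_(i < m) mu i = alpha *: \row_j
      ((\row_j (symbol m Lo ho j ^+ Mo)) 0 j *
       (\row_i \sum_(r < zeta) symbol (zeta * m) Lb hb (i + r * m) ^- Mb) 0 j).
    by apply/rowP => i; rewrite !mxE mulr_sumr.
  rewrite [diag_mx (_ *: _)]linearZ /= -!(scalemxAl, scalemxAr) scalerA.
  congr (_ *: _).
  have so := cov_scale_gt0 Mo so0 Lo0 ho0.
  (* The ratio of the covariance scales is [alpha * (ho / hb)]; here [ho / hb = zeta] cancels the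
     [zeta] in [n = zeta * m], leaving [alpha / m]. *)
  have -> : alpha =
      cov_scale Mb sigmab Lb hb * hb / (cov_scale Mo sigmao Lo ho * ho).
    by rewrite /alpha /cov_scale !divfK ?gt_eqF.
  move: (cov_scale _ _ _ ho) so => c c0; rewrite natrM hoE; field.
  by rewrite mR zR !gt_eqF.
have chYX : char_poly (Y *m X) = \prod_(i < m) ('X - (mu i)%:P).
  rewrite YX char_poly_conj; last first.
    by rewrite -scalemxAl hartley_sqr// scale_scalar_mx mulVf.
  by rewrite char_poly_diag; apply: eq_bigr => i _; rewrite mxE.
have chXY : char_poly (X *m Y) =
    \prod_(i < n) ('X - (if (i < m)%N then mu i else 0)%:P).
  have mn : (m <= n)%N by rewrite -nE leq_pmull.
  (* The swap yields 'X^m on one side and 'X^n on the other; the surplus 'X^(n - m) supplies the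
     zero eigenvalues at indices [i >= m]. *)
  apply: (@mulfI _ 'X^m); first by rewrite expf_neq0 ?polyX_eq0.
  rewrite char_poly_mulmxC chYX.
  pose f i : {poly R} := 'X - (if (i < m)%N then mu i else 0)%:P.
  rewrite -(big_mkord xpredT f) (@big_cat_nat _ _ _ m)//= mulrCA mulrC.
  rewrite !big_mkord; congr (_ * _).
    by apply: eq_bigr => i _; rewrite /f ltn_ord.
  rewrite (eq_big_nat _ _ (F2 := fun=> 'X)).
    by rewrite prodr_const_nat -exprD subnKC.
  by move=> i /andP[mi _]; rewrite /f ltnNge mi subr0.
have -> : S = 1%:M + X *m Y by rewrite SE /X /Y !mulmxA.
rewrite char_poly_add1 chXY rmorph_prod; apply: eq_bigr => i _.
rewrite /= comp_polyB comp_polyX comp_polyC.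
by rewrite lambdaE polyCD polyC1 opprD addrA.
Qed.
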